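(* Let $E$ be a Banach space, let $X$ be a nonempty, bounded, closed and convex subset of $E$, let $\mu$ be an arbitrary measure of noncompactness in $E$, and let $n\ge 1$ be an integer. Let $\varphi:\mathbb{R}^{+}\to\mathbb{R}^{+}$ be a nondecreasing and upper semicontinuous function such that $\varphi(r)<r$ for all $r>0$. Suppose that $G:X^{n}\to P_{cl,cv}(X)$ is a continuous multivalued operator satisfying $$\mu\bigl(G(X_{1}\times X_{2}\times\cdots\times X_{n})\bigr)\le \varphi\left(\frac{\mu(X_{1})+\mu(X_{2})+\cdots+\mu(X_{n})}{n}\right)$$ for all (nonempty) subsets $X_{1},X_{2},\dots,X_{n}\subset X$. Then $G$ has at least one $n$-tuplet fixed point, i.e. there exists $(x_{1},x_{2},\dots,x_{n})\in X^{n}$ such that $$x_{1}\in G(x_{1},x_{2},\dots,x_{n}),\quad x_{2}\in G(x_{2},x_{3},\dots,x_{n},x_{1}),\quad \dots,\quad x_{n}\in G(x_{n},x_{1},\dots,x_{n-1}).$$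
   Context: Here $\mathbb{R}^{+}=[0,\infty)$. $P_{cl,cv}(X)$ denotes the class of all nonempty closed convex subsets of $X$; $P_{cl,bd}(E)$ denotes the class of all nonempty closed bounded subsets of $E$; $P_{rcp}(E)$ denotes the class of all nonempty relatively compact subsets of $E$. For a multivalued map $G$ and a set $A$ in its domain, $G(A)=\bigcup_{a\in A}G(a)$. A measure of noncompactness in $E$ is a mapping $\mu:P_{cl,bd}(E)\to\mathbb{R}^{+}$, with values on arbitrary nonempty bounded sets understood through (M2), such that: (M1) $\varnothing\neq\mu^{-1}(0)\subset P_{rcp}(E)$; (M2) $\mu(\overline{A})=\mu(A)$, where $\overline{A}$ is the closure of $A$; (M3) $\mu(\mathrm{conv}\,A)=\mu(A)$, where $\mathrm{conv}\,A$ is the convex hull of $A$; (M4) $\mu$ is nondecreasing: $A\subseteq B$ implies $\mu(A)\le\mu(B)$; (M5) if $\{A_{m}\}$ is a decreasing sequence of sets in $P_{cl,bd}(E)$ with $\lim_{m\to\infty}\mu(A_{m})=0$, then $A_{\infty}=\bigcap_{m=1}^{\infty}A_{m}$ is nonempty. *)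

(* Defs.v *)
From HB Require Import structures.
From mathcomp Require Import all_boot all_order all_algebra.
From mathcomp Require Import all_classical all_reals all_analysis.

Set Implicit Arguments.
Unset Strict Implicit.
Unset Printing Implicit Defensive.

Import Order.TTheory GRing.Theory Num.Theory.
Import numFieldNormedType.Exports.

Local Open Scope classical_set_scope.
Local Open Scope ring_scope.

Section SetClasses.
Context {R : realType} {E : normedModType R}.

Definition P_bd : set (set E) := [set A | A !=set0 /\ bounded_set A].

Definition P_cl_bd : set (set E) :=
  [set A | [/\ A !=set0, closed A & bounded_set A]].

(* [precompact A] means that [closure A] is compact, by [precompactE]. *)
Definition P_rcp : set (set E) := [set A | A !=set0 /\ precompact A].

Definition P_cl_cv (X : set E) : set (set E) :=
  [set A | [/\ A !=set0, closed A, @convex_set R E A & A `<=` X]].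

Definition conv_hull (A : set E) : set E := smallest (@convex_set R E) A.

(* A measure of noncompactness is defined on [P_cl_bd] and extended to [P_bd]
   by [mnc_closure].  It is encoded as a total function whose values outside
   [P_bd] are unconstrained. *)
Record measure_of_noncompactness (mu : set E -> R) : Prop := {
  mnc_ge0 : forall A, P_cl_bd A -> 0 <= mu A;
  mnc_ker_neq0 : P_cl_bd `&` mu @^-1` [set 0] !=set0;
  mnc_ker_rcp : P_cl_bd `&` mu @^-1` [set 0] `<=` P_rcp;
  mnc_closure : forall A, P_bd A -> mu (closure A) = mu A;
  mnc_conv : forall A, P_bd A -> mu (conv_hull A) = mu A;
  mnc_mono : forall A B, P_bd A -> P_bd B -> A `<=` B -> mu A <= mu B;
  mnc_bigcap : forall A : nat -> set E,
    (forall m, P_cl_bd (A m)) -> (forall m, A m.+1 `<=` A m) ->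
    mu (A m) @[m --> \oo] --> 0 -> \bigcap_m A m !=set0
}.

End SetClasses.

(* A multivalued map on a subset [D] of [T] is encoded as a total function
   [G : T -> set U] considered only on [D]; "open" below means relatively open
   in [D]. *)
Section Semicontinuity.
Context {T U : topologicalType}.

Definition multi_usc_on (D : set T) (G : T -> set U) :=
  forall V : set U, open V ->
    open ([set x | D x /\ G x `<=` V] : set (subspace D)).

Definition multi_lsc_on (D : set T) (G : T -> set U) :=
  forall V : set U, open V ->
    open ([set x | D x /\ G x `&` V !=set0] : set (subspace D)).

Definition multi_continuous_on (D : set T) (G : T -> set U) :=
  multi_usc_on D G /\ multi_lsc_on D G.

End Semicontinuity.

Definition real_usc_on {R : realType} {T : topologicalType}
    (D : set T) (f : T -> R) :=
  forall a : R, open ([set t | D t /\ f t < a] : set (subspace D)).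

Definition box {n : nat} {T : Type} (X_ : 'I_n -> set T) : set {ptws 'I_n -> T} :=
  [set x | forall i, X_ i (x i)].

Definition multi_image {S T : Type} (G : S -> set T) (A : set S) : set T :=
  \bigcup_(a in A) G a.

(* (x_i, x_(i+1), ..., x_(n-1), x_0, ..., x_(i-1)): the j-th entry is
   x_((i + j) mod n), [ordS] being the cyclic successor on ['I_n]. *)
Definition cyclic_shift {n : nat} {T : Type} (i : 'I_n)
    (x : {ptws 'I_n -> T}) : {ptws 'I_n -> T} :=
  fun j => x (iter j (@ordS n) i).

(* Main.v *)
Require Import Defs.
From HB Require Import structures.
From mathcomp Require Import all_boot all_order all_algebra.
From mathcomp Require Import finmap zify.
From mathcomp Require Import all_classical all_reals all_analysis.

Set Implicit Arguments.
Unset Strict Implicit.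
Unset Printing Implicit Defensive.

(** The cyclic structure of the conclusion is harmless: a constant tuple
    (x, ..., x) is invariant under cyclic shifts, so it suffices to find a
    fixed point of the diagonal map H x = G(x, ..., x).  Taking all the [X_ i]
    equal in the contraction hypothesis gives mu(H(A)) <= phi(mu(A)) for every
    nonempty A included in X, as in Darbo's theorem.

    Darbo's argument then produces a compact convex set stable under H.  Let
    A_0 = X and let A_(k+1) be the closed convex hull of H(A_k); the measures
    mu(A_k) satisfy u_(k+1) <= phi(u_k), hence tend to 0
    ([comparison_cvg0]), so that the intersection K of the A_k is nonempty,
    of measure 0, compact, convex and stable ([mnc_invariant_compact]).

    It remains to find a fixed point of H on K ([kakutani]).  Fix e > 0.  By
    lower semicontinuity and compactness there are finitely many points
    y_1, ..., y_m in K and a scale l such that every ball of radius l in K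
    admits some j for which H comes within e of y_j at all its points.
    Coloring a point of a fine grid in the standard simplex by such a j at the
    corresponding convex combination of the y_j, one looks for a grid point z
    all of whose positive coordinates are colors of nearby points: at the
    convex combination P(z), the value of H then comes within e of y_j
    whenever z_j > 0, hence, being convex, within e of P(z)
    ([approx_fixed_point]).  Upper semicontinuity and compactness turn
    approximate fixed points into a fixed point.

    The existence of z ([scarf_grid]) is a form of the
    Knaster-Kuratowski-Mazurkiewicz lemma.  It is derived without any
    triangulation from a theorem of Scarf about a finite set with m total
    orders ([scarf]), where the dominant sets of m elements take the place of
    the simplices of a triangulation and are counted modulo 2 as in Sperner's
    lemma. *)

(** * Finite sets with several total orders *)

Section Scarf.

Import boot.fintype boot.finset.

(** Such an [f] identifies exactly one pair of elements of [A], and these are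
    the two elements in question.  In the proof of Scarf's theorem this accounts
    both for the two facets, with all the colors but one, of a cell missing one
    color, and for the two cells adjacent to a facet. *)
Lemma card_redundant (T U : finType) (f : T -> U) (A : {set T}) :
  #|A| = #|f @: A|.+1 -> #|[set x in A | f @: (A :\ x) == f @: A]| = 2.
Proof.
move=> cA.
have [x xA [y yA [yx fxy]]] :
    exists2 x, x \in A & exists2 y, y \in A & y != x /\ f y = f x.
  have ninj : ~~ dinjectiveb f (mem A).
    apply/negP => /dinjectiveP/card_in_imset cfA.
    by have := ltnn #|f @: A|; rewrite {2}cfA cA ltnS leqnn.
  by have [x xA [y /andP[yx yA] fxy]] := dinjectivePn f (mem A) ninj; exists x => //; exists y.
have redundant u v : u \in A -> v \in A -> v != u -> f v = f u ->
    f @: (A :\ u) = f @: A.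
  move=> uA vA vu fvu; apply/eqP; rewrite eqEsubset imsetS ?subD1set //=.
  apply/subsetP => _ /imsetP[w wA ->]; have [->|wu] := eqVneq w u.
    by rewrite -fvu imset_f // !inE vu.
  by rewrite imset_f // !inE wu.
have injx : {in A :\ x &, injective f}.
  apply/imset_injP; rewrite (redundant x y) //; apply/eqP/succn_inj.
  by rewrite -cA (cardsD1 x A) xA.
rewrite (_ : [set _ in _ | _] = [set x; y]) ?cards2 1?eq_sym ?yx //.
apply/setP => z; rewrite !inE; have [->|zx] := eqVneq z x.
  by rewrite xA (redundant x y) // eqxx.
have [->|zy] := eqVneq z y; first by rewrite yA (redundant y x) ?eqxx // eq_sym.
apply/negP => /andP[zA /eqP fAz].
have : f z \in f @: (A :\ z) by rewrite fAz imset_f.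
move=> /imsetP[w /setD1P[wz wA] fzw].
have [wx|wx] := eqVneq w x.
  case/eqP: zy; apply: injx; rewrite ?inE ?zx ?yx ?zA ?yA //.
  by rewrite fzw wx fxy.
by case/eqP: wz; apply: injx; rewrite ?inE ?wx ?wA ?zx ?zA.
Qed.

(** The total orders on [Y] are given by ranks.  The dummy [d i] is the least
    element for the order [i] and lies above all genuine elements for the
    other orders.  Adding dummies makes sets of [m] elements, rather than
    pairs formed by a set and a subset of the orders, the only cells to
    consider: a cell containing [d i] ignores the order [i]. *)
Variables (m : nat) (Y : finType) (r : 'I_m -> Y -> nat) (d : 'I_m -> Y).
Hypothesis r_inj : forall i, injective (r i).
Hypothesis d_least : forall i y, y != d i -> r i (d i) < r i y.
Hypothesis d_large : forall i j y, j != i -> y \notin codom d -> r i y < r i (d j).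
Variable y0 : Y.
Hypothesis y0_genuine : y0 \notin codom d.
Hypothesis m_gt1 : 1 < m.

Lemma dummy_inj : injective d.
Proof.
move=> i j dij; apply/eqP; apply: contraT => ij.
have /= := d_large (i:=i) (j:=j) _ y0_genuine; rewrite eq_sym ij -dij => /(_ isT).
have : y0 != d i by apply: contraNneq y0_genuine => ->; rewrite codom_f.
by move=> /d_least /ltnW; rewrite leqNgt => /negP h /h.
Qed.

(** Dominant sets stand for the faces of the simplices of a triangulation: no
    element being strictly above [s] for all the orders at once, the elements
    of [s] are packed together. *)
Definition dominant (s : {set Y}) :=
  [forall y, exists i, [forall x in s, r i y <= r i x]].

Lemma dominantP (s : {set Y}) :
  reflect (forall y, exists i, forall x, x \in s -> r i y <= r i x) (dominant s).
Proof.
apply: (iffP forallP) => H y.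
  by have /existsP[i /forall_inP h] := H y; exists i.
by have [i h] := H y; apply/existsP; exists i; apply/forall_inP.
Qed.

Lemma dominantS (s t : {set Y}) : s \subset t -> dominant t -> dominant s.
Proof.
move=> /subsetP st /dominantP H; apply/dominantP => y.
by have [i h] := H y; exists i => x /st; apply: h.
Qed.

(** The default value [d i] is only reached when [t] is empty. *)
Definition lowest (t : {set Y}) (i : 'I_m) : Y :=
  if [pick x in t] is Some x0 then [arg min_(x < x0 in t) r i x] else d i.

Lemma lowestP (t : {set Y}) i : t != set0 ->
  lowest t i \in t /\ forall x, x \in t -> r i (lowest t i) <= r i x.
Proof.
rewrite /lowest; case: pickP => [x0 x0t _|t0 /set0Pn[x]]; last by rewrite (t0 x).
by case: arg_minnP => // z zt zmin; split.
Qed.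

Lemma lowest_uniq (t : {set Y}) i x : x \in t -> (forall y, y \in t -> r i x <= r i y) ->
  lowest t i = x.
Proof.
move=> xt xmin; have tn0 : t != set0 by apply/set0Pn; exists x.
have [lt lmin] := lowestP i tn0.
by apply: (r_inj (i := i)); apply/eqP; rewrite eqn_leq lmin ?xmin.
Qed.

(** An element that is lowest for no order would lie strictly above the whole
    set.  Consequently a dominant set has at most [m] elements, and in one
    with [m] elements each element is lowest for exactly one order. *)
Lemma dominant_lowest (t : {set Y}) : t != set0 -> dominant t -> lowest t @: setT = t.
Proof.
move=> tn0 /dominantP domt; apply/setP => x; apply/imsetP/idP => [[i _ ->]|xt].
  by case: (lowestP i tn0).
by have [i h] := domt x; exists i => //; rewrite (lowest_uniq (x:=x)).
Qed.

Definition above (t : {set Y}) (k : 'I_m) : {set Y} :=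
  [set y | [forall (l | l != k), r l (lowest t l) < r l y]].

Lemma aboveP (t : {set Y}) k y :
  reflect (forall l, l != k -> r l (lowest t l) < r l y) (y \in above t k).
Proof. by rewrite inE; apply: (iffP forall_inP). Qed.

(** The orders that can be forgotten while still obtaining every element of
    [t] as lowest for one of the remaining orders. *)
Definition spare (t : {set Y}) : {set 'I_m} := [set k | lowest t @: (setT :\ k) == t].

Definition completions (t : {set Y}) : {set Y} :=
  [set x | (x \notin t) && dominant (x |: t)].

Lemma card_spare (t : {set Y}) : #|t|.+1 = m -> dominant t -> #|spare t| = 2.
Proof.
move=> ct domt; have tn0 : t != set0 by rewrite -card_gt0 -ltnS ct.
have := @card_redundant _ _ (lowest t) setT.
rewrite dominant_lowest // cardsT card_ord ct => /(_ erefl) <-.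
by apply: eq_card => k; rewrite !inE.
Qed.

(** The pivot step.  Completing a facet [t] into a cell by adding [x] makes
    [x] the lowest element for exactly one order [k], and the other orders
    must still account for all of [t]: the order [k] is spare.  Conversely, for
    a spare [k], dominance forces [x] to be the greatest element, for the order
    [k], among those above [t] for the other orders. *)
Lemma card_completions (t : {set Y}) : #|t|.+1 = m -> dominant t ->
  #|completions t| = #|[set k in spare t | above t k != set0]|.
Proof.
move=> ct domt; have tn0 : t != set0 by rewrite -card_gt0 -ltnS ct.
have [top topP] : exists top : 'I_m -> Y, forall k, above t k != set0 ->
    top k \in above t k /\ forall y, y \in above t k -> r k y <= r k (top k).
  apply: (@fin_all_exists _ _ (fun k x => above t k != set0 ->
    x \in above t k /\ forall y, y \in above t k -> r k y <= r k x)) => k /=.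
  have [->|/set0Pn[y yt]] := eqVneq (above t k) set0; first by exists y0.
  by exists [arg max_(x > y in above t k) r k x] => _; case: arg_maxnP.
set K := [set k in spare t | _].
have lowestK k l : k \in K -> exists2 j, j != k & lowest t l = lowest t j.
  rewrite inE => /andP[]; rewrite inE => /eqP tk _.
  have := (lowestP l tn0).1; rewrite -{2}tk => /imsetP[j]; rewrite !inE andbT => jk lj.
  by exists j.
(* Otherwise [top k] would lie strictly above [t] for all the orders. *)
have top_below k : k \in K -> r k (top k) < r k (lowest t k).
  move=> kK; have [_] := setIdP kK; move=> /topP[/aboveP topk _].
  have /dominantP/(_ (top k))[i topi] := domt.
  have [ik|/topk] := eqVneq i k.
    have [j jk lkj] := lowestK k k kK.
    have := topi _ (lowestP i tn0).1; rewrite ik leq_eqVlt => /predU1P[|//].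
    by move=> /r_inj e; have := topk j jk; rewrite e lkj ltnn.
  by rewrite ltnNge topi //; case: (lowestP i tn0).
have top_notin k : k \in K -> top k \notin t.
  move=> /top_below; apply: contraTN => /(lowestP k tn0).2.
  by rewrite -leqNgt.
rewrite -(card_in_imset (f := top) (D := K)); last first.
  move=> k k' kK k'K kk'; apply/eqP; apply: contraT => nkk'.
  have := top_below k kK; have [_ /topP[/aboveP/(_ k nkk')]] := setIdP k'K.
  by rewrite kk' => /ltnW; rewrite leqNgt => /negPf ->.
apply: eq_card => x; rewrite inE; apply/andP/imsetP => [[xt domx]|[k kK ->]]; last first.
  split; first exact: top_notin.
  apply/dominantP => y; have [ya|/aboveP nya] := boolP (y \in above t k).
    exists k => z; rewrite !inE => /predU1P[->|].
      by have [_ /topP[_]] := setIdP kK; apply.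
    move=> /(lowestP k tn0).2; apply: leq_trans.
    by apply: ltnW; apply: leq_ltn_trans (top_below k kK); have [_ /topP[_]] := setIdP kK; apply.
  have : ~~ [forall (l | l != k), r l (lowest t l) < r l y].
    by apply/negP => /forall_inP.
  rewrite negb_forall_in => /exists_inP[l lk]; rewrite -leqNgt => yl.
  exists l => z; rewrite !inE => /predU1P[->|].
    have [_ /topP[/aboveP/(_ l lk)]] := setIdP kK.
    by move=> /ltnW ltop _; apply: leq_trans ltop.
  by move=> /(lowestP l tn0).2; apply: leq_trans.
have xtn0 : x |: t != set0 by apply/set0Pn; exists x; rewrite setU11.
have lowx := dominant_lowest xtn0 domx.
have linj : injective (lowest (x |: t)).
  have : {in setT &, injective (lowest (x |: t))}.
    by apply/imset_injP; rewrite lowx cardsT card_ord cardsU1 xt -ct.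
  by move=> h a b; apply: h; rewrite inE.
have : x \in lowest (x |: t) @: setT by rewrite lowx setU11.
move=> /imsetP[k _ xk].
have lowt l : l != k -> lowest t l = lowest (x |: t) l.
  move=> lk; apply: lowest_uniq.
    have := (lowestP l xtn0).1; rewrite !inE => /predU1P[|//].
    by rewrite {2}xk => /linj/eqP; rewrite (negPf lk).
  by move=> y yt; apply: (lowestP l xtn0).2; rewrite inE yt orbT.
have xabove : x \in above t k.
  apply/aboveP => l lk; rewrite lowt // ltn_neqAle (lowestP l xtn0).2 ?setU11 // andbT.
  apply: contraNneq xt => /r_inj <-; rewrite -lowt //.
  by case: (lowestP l tn0).
have kK : k \in K.
  rewrite inE; apply/andP; split; last by apply/set0Pn; exists x.
  rewrite inE; apply/eqP/setP => y; apply/imsetP/idP => [[l _ ->]|yt].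
    by case: (lowestP l tn0).
  have : y \in lowest (x |: t) @: setT by rewrite lowx inE yt orbT.
  move=> /imsetP[l _ yl]; have lk : l != k.
    by apply: contraNneq xt => lk; rewrite xk -lk -yl.
  by exists l; rewrite ?lowt // !inE lk.
exists k => //; apply: (r_inj (i := k)); apply/eqP; rewrite eqn_leq.
have [_ /topP[topa topmax]] := setIdP kK; rewrite topmax //=.
have /dominantP/(_ (top k))[i topi] := domx.
have [ik|ik] := eqVneq i k; first by move: topi; rewrite ik; apply; rewrite setU11.
have /aboveP/(_ _ ik) := topa; rewrite ltnNge topi // inE.
by apply/orP; right; case: (lowestP i tn0).
Qed.

(** A facet containing a genuine element lies in exactly two cells, since the
    dummy [d k] is a candidate for pivoting along any order [k]. *)
Lemma completions_genuine (t : {set Y}) x : #|t|.+1 = m -> dominant t ->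
  x \in t -> x \notin codom d -> #|completions t| = 2.
Proof.
move=> ct domt xt xd; rewrite card_completions // -(card_spare ct domt).
have tn0 : t != set0 by apply/set0Pn; exists x.
apply: eq_card => k; rewrite inE; apply: andb_idr => kt; apply/set0Pn; exists (d k).
have xdl l : x != d l by apply: contraNneq xd => ->; rewrite codom_f.
have below l : r l (lowest t l) <= r l x by apply: (lowestP l tn0).2.
apply/aboveP => l lk; apply: leq_ltn_trans (below l) _.
by apply: d_large => //; rewrite eq_sym.
Qed.

Lemma dominant_dummies a : dominant (d @: [set~ a]).
Proof.
apply/dominantP => y; have [/codomP[l ->]|yd] := boolP (y \in codom d).
  exists l => x /imsetP[j ja ->]; have [->//|jl] := eqVneq (d j) (d l).
  exact/ltnW/d_least.
exists a => x /imsetP[j]; rewrite !inE => ja ->.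
exact/ltnW/d_large.
Qed.

Lemma card_dummies a : #|d @: [set~ a]|.+1 = m.
Proof. by rewrite card_imset ?cardsC1 ?card_ord ?(ltn_predK m_gt1) //; apply: dummy_inj. Qed.

(** A facet made only of dummies is on the boundary: it can be completed along
    the order [a], with a genuine element; along the other spare order [k], a
    new element would have to lie above [d k] for the order [a], which holds
    neither for genuine elements nor for [d a]. *)
Lemma completions_dummies a : #|completions (d @: [set~ a])| = 1.
Proof.
set t := d @: _; have ct := card_dummies a; have domt := dominant_dummies a.
rewrite card_completions //.
have tn0 : t != set0 by rewrite -card_gt0 -ltnS ct.
have lowd l : l != a -> lowest t l = d l.
  move=> la; apply: lowest_uniq; first by rewrite imset_f // !inE.
  move=> _ /imsetP[j _ ->]; have [->//|jl] := eqVneq (d j) (d l).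
  exact/ltnW/d_least.
rewrite (_ : [set _ in _ | _] = [set a]) ?cards1 //; apply/setP => k; rewrite !inE.
apply/andP/eqP => [[/eqP tk /set0Pn[y /aboveP ya]]|->].
  apply/eqP; apply: contraT => ka.
  have ltay : r a (lowest t a) < r a y by apply: ya; rewrite eq_sym.
  have lka : lowest t a = d k.
    have : d k \in t by rewrite imset_f // !inE.
    rewrite -{1}tk => /imsetP[l]; rewrite !inE andbT => lk.
    have [->//|la] := eqVneq l a; rewrite lowd // => /dummy_inj kl.
    by rewrite kl eqxx in lk.
  have : y \in codom d.
    apply: contraT => yd; move: (ltay).
    by rewrite lka ltnNge ltnW // d_large.
  move=> /codomP[l yl]; have [la|la] := eqVneq l a.
    move: ltay; rewrite ltnNge yl la.
    by have [->|/d_least/ltnW->] := eqVneq (lowest t a) (d a); rewrite ?leqnn.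
  have [lk|lk] := eqVneq l k; first by move: ltay; rewrite lka yl lk ltnn.
  by have := ya l lk; rewrite lowd // yl ltnn.
split.
  apply/eqP/setP => y; apply/imsetP/imsetP => [] [l]; rewrite !inE ?andbT => la ->.
    by exists l; rewrite ?inE // lowd.
  by exists l; rewrite ?inE ?andbT // lowd.
apply/set0Pn; exists y0; apply/aboveP => l la; rewrite lowd //.
by apply: d_least; apply: contraNneq y0_genuine => ->; rewrite codom_f.
Qed.

(** Scarf's theorem.  Count the pairs of a cell and a facet of it whose colors
    are all the colors but [a].  Summing over facets, each contributes zero
    or two cells except the single one made of dummies, which contributes one:
    the number is odd.  Summing over cells, a cell that misses a color
    contributes zero or two facets; hence some cell has all the colors. *)
Lemma scarf (c : Y -> 'I_m) : (forall i, c (d i) = i) ->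
  exists2 s : {set Y}, dominant s & c @: s = setT.
Proof.
move=> cd; pose a : 'I_m := Ordinal (ltnW m_gt1).
pose cell (s : {set Y}) := dominant s && (#|s| == m).
pose facet (t : {set Y}) := (#|t|.+1 == m) && (c @: t == [set~ a]).
(* Both sums count the pairs (s, x) such that s is a cell, x is in s and
   s :\ x is a facet. *)
have count : \sum_(s | cell s) #|[set x in s | c @: (s :\ x) == [set~ a]]|
           = \sum_(t | facet t) #|completions t|.
  transitivity (\sum_x \sum_(s | [&& cell s, x \in s & c @: (s :\ x) == [set~ a]]) 1).
    under eq_bigr do rewrite -sum1_card.
    under eq_bigr do under eq_bigl do rewrite inE.
    rewrite (exchange_big_dep predT) //=.
  transitivity (\sum_x \sum_(t | facet t && (x \in completions t)) 1); last first.
    under [RHS]eq_bigr do rewrite -sum1_card.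
    by rewrite [RHS](exchange_big_dep predT).
  apply: eq_bigr => x _.
  rewrite (reindex_onto (fun t => x |: t) (fun s => s :\ x)) /=; last first.
    by move=> s /and3P[_ xs _]; rewrite setD1K.
  apply: eq_bigl => t; rewrite /facet /cell setU11 [x \in completions t]inE /=.
  have [xt|xt] := boolP (x \in t).
    rewrite andbF; apply/negP => /andP[_ /eqP e].
    by move: xt; rewrite -e !inE eqxx.
  rewrite setU1K // eqxx cardsU1 xt add1n /= andbT.
  by rewrite -andbA andbC -andbA.
suff /exists_inP[s doms /eqP cs] : [exists s in dominant, c @: s == setT] by exists s.
apply: contraT; rewrite negb_exists_in => /forall_inP nofull.
have even_cells : 2 %| \sum_(s | cell s) #|[set x in s | c @: (s :\ x) == [set~ a]]|.
  apply: dvdn_sum => s /andP[doms /eqP cs].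
  set g := [set x in s | _].
  have [->|/set0Pn[x]] := eqVneq g set0; first by rewrite cards0.
  rewrite !inE => /andP[xs /eqP csx].
  have cas : c @: s = [set~ a].
    apply/eqP; rewrite eq_sym eqEsubset -{1}csx imsetS ?subD1set //=.
    apply/subsetP => i ci; rewrite !inE; apply: contraTneq ci => ->.
    apply: contra (nofull s doms) => ca; rewrite eqEsubset subsetT /=.
    apply/subsetP => j _; have [->//|ja] := eqVneq j a.
    have : j \in c @: (s :\ x) by rewrite csx !inE.
    by apply/subsetP; rewrite imsetS ?subD1set.
  rewrite /g -cas card_redundant // cas cardsC1 card_ord (ltn_predK m_gt1) //.
have facet_d : facet (d @: [set~ a]).
  rewrite /facet card_dummies eqxx /=; apply/eqP; rewrite -imset_comp.
  by rewrite (eq_imset _ (g := id)) ?imset_id.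
move: even_cells; rewrite count (bigD1 _ facet_d) /= completions_dummies.
rewrite dvdn_addl //; apply: dvdn_sum => t /andP[/andP[/eqP ct /eqP cta] td].
have [domt|ndomt] := boolP (dominant t); last first.
  rewrite (_ : completions t = set0) ?cards0 //; apply/setP => x; rewrite !inE.
  apply: contraNF ndomt => /andP[_]; apply: dominantS; exact: subsetUr.
have [/exists_inP[x xt xd]|tcodom] := boolP [exists x in t, x \notin codom d].
  by rewrite (completions_genuine (x := x)).
move: tcodom; rewrite negb_exists_in => /forall_inP tcodom.
case/eqP: td; apply/eqP; rewrite eqEcard (_ : t \subset _) /=.
  by rewrite -ltnS card_dummies ct.
apply/subsetP => x xt; have := tcodom x xt; rewrite negbK => /codomP[i xi].
rewrite xi imset_f // !inE; apply: contraTneq (_ : c x \in [set~ a]) => [ia|].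
  by rewrite xi cd ia !inE eqxx.
by rewrite -cta imset_f.
Qed.

End Scarf.

(** * Colorings of the integer points of a simplex *)

Section Grid.
Import boot.fintype boot.finset.
Variables (m k : nat).
Hypothesis m_gt1 : 1 < m.

(** The points with coordinates in (1/k)Z of the standard simplex, scaled by
    [k]. *)
Definition grid := {p : {ffun 'I_m -> 'I_k.+1} | \sum_i p i == k}.

Lemma grid_surj (f : 'I_m -> nat) : \sum_i f i = k ->
  exists p : grid, forall i, val p i = f i :> nat.
Proof.
move=> fk; have fle i : f i < k.+1 by rewrite ltnS -fk (bigD1 i) //= leq_addr.
have pk : \sum_i [ffun j => Ordinal (fle j)] i == k.
  by apply/eqP; rewrite -[RHS]fk; apply: eq_bigr => i _; rewrite ffunE.
by exists (exist _ [ffun j => Ordinal (fle j)] pk) => i; rewrite /= ffunE.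
Qed.

Lemma sum_add_at (a : 'I_m -> nat) i0 e :
  \sum_i (a i + (i == i0) * e) = \sum_i a i + e.
Proof.
rewrite big_split /=; congr addn.
by rewrite (bigD1 i0) //= eqxx mul1n big1 ?addn0 // => i /negPf ->.
Qed.

(** The order [i] on grid points compares the [i]-th coordinates and breaks
    ties by an arbitrary enumeration of the grid; the summands [inl j] are the
    dummies of Scarf's theorem. *)
Definition rank (i : 'I_m) (y : 'I_m + grid) : nat :=
  match y with
  | inl j => if j == i then 0 else (k.+1 * #|{: grid}| + j).+1
  | inr p => (val p i * #|{: grid}| + enum_rank p).+1
  end.

Lemma rank_grid_lt i (p : grid) : val p i * #|{: grid}| + enum_rank p < k.+1 * #|{: grid}|.
Proof.
apply: leq_trans (_ : (val p i).+1 * #|{: grid}| <= _); last by rewrite leq_mul2r ltn_ord orbT.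
by rewrite mulSn addnC ltn_add2r.
Qed.

Lemma rank_inj i : injective (rank i).
Proof.
move=> [j|p] [j'|p'] /=.
- case: eqVneq => [->|ji]; case: eqVneq => [->|j'i] //= [] /eqP.
  by rewrite eqn_add2l => /eqP jj; congr inl; apply: val_inj.
- by case: eqP => // _ [] e; have := rank_grid_lt i p'; rewrite -e -addSn ltnNge leq_addr.
- by case: eqP => // _ [] e; have := rank_grid_lt i p; rewrite e ltnNge leq_addr.
case=> e; congr inr; apply: enum_rank_inj; apply: val_inj.
have := congr1 (modn^~ #|{: grid}|) e; rewrite /= !modnMDl !modn_small //.
Qed.

(** Let [s] be the dominant set with all colors given by Scarf's theorem, [I]
    the set of orders whose dummy is not in [s], and [a i], for [i] in [I], the
    least [i]-th coordinate of the grid points of [s].  If the sum of [a i + 1]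
    over [I] were at most [k], some grid point would have all its coordinates in
    [I] larger than those of [a], against dominance.  So [a], extended by 0
    outside [I], has sum at least [k - m], and all the grid points of [s], as
    well as any grid point [z >= a], are close to [a] and hence to each other.
    Choosing [z] supported in [I] is enough, because a color [i] in [I] must be
    carried by a grid point of [s]. *)
Lemma scarf_grid (c : ('I_m -> nat) -> 'I_m) :
  exists z : 'I_m -> nat, \sum_i z i = k /\ forall i, 0 < z i ->
    exists s : 'I_m -> nat, [/\ \sum_j s j = k, c s = i &
      \sum_j ((s j - z j) + (z j - s j)) <= 2 * m].
Proof.
pose o : 'I_m := Ordinal (ltnW m_gt1).
have [y0 _] : exists p : grid, forall i, val p i = (0 + (i == o) * k) :> nat.
  by apply: grid_surj; rewrite sum_add_at big1.
pose col (y : 'I_m + grid) := match y with inl j => j | inr p => c (fun i => val p i) end.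
have notdummy (p : grid) : inr p \notin codom (inl : 'I_m -> 'I_m + grid).
  by apply/codomP => [] [].
have dummy (y : 'I_m + grid) : y \notin codom (inl : 'I_m -> 'I_m + grid) -> exists p, y = inr p.
  by case: y => [j|p _]; [rewrite codom_f|exists p].
have [] := @scarf m ('I_m + grid)%type rank inl rank_inj _ _ (inr y0) (notdummy y0) m_gt1 col.
- by move=> i [j|p]; rewrite /= eqxx //; case: (eqVneq j i) => [->|//]; rewrite eqxx.
- move=> i j y ji /dummy[p ->] /=; rewrite (negPf ji) ltnS.
  by apply: leq_trans (leq_addr _ _); apply: rank_grid_lt.
- by [].
move=> s /dominantP doms cols.
have real i : inl i \notin s -> exists2 p, inr p \in s & c (fun j => val p j) = i.
  move=> iN; have : i \in col @: s by rewrite cols inE.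
  move=> /imsetP[[j|p] ps /= e]; last by exists p.
  by rewrite e ps in iN.
have [i0 i0N] : exists i, inl i \notin s.
  have [i imin] := doms (inr y0); exists i; apply/negP => /imin.
  by rewrite /= eqxx.
have [p0 p0s _] := real i0 i0N.
pose low i := [arg min_(p < p0 | inr p \in s) (val p i : nat)].
pose a i := if inl i \in s then 0 else val (low i) i : nat.
have lowP i : inr (low i) \in s /\ forall p, inr p \in s -> val (low i) i <= val p i.
  by rewrite /low; case: arg_minnP => // p ps pmin; split.
have ale p i : inr p \in s -> a i <= val p i.
  by move=> ps; rewrite /a; case: ifP => // _; apply: (lowP i).2.
have sumgrid (p : grid) : \sum_i val p i = k by apply/eqP; exact: (valP p).
have sa : \sum_i a i <= k by rewrite -(sumgrid p0); apply: leq_sum => i _; apply: ale.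
have ka : k < \sum_i a i + m.
  rewrite ltnNge; apply/negP => le.
  have lea : \sum_i (a i + (inl i \notin s)) <= k.
    rewrite big_split /=; apply: leq_trans le; rewrite leq_add2l.
    rewrite -[leqRHS](card_ord m) -sum1_card.
    by apply: leq_sum => i _; case: (_ \notin _).
  have [q qE] : exists q : grid, forall i, val q i =
      a i + (inl i \notin s) + (i == i0) * (k - \sum_i (a i + (inl i \notin s))) :> nat.
    by apply: grid_surj; rewrite sum_add_at subnKC.
  have [i imin] := doms (inr q).
  have iN : inl i \notin s by apply/negP => /imin; rewrite /= eqxx.
  have := imin _ (lowP i).1; rewrite /= ltnS leqNgt => /negP; apply.
  apply: leq_trans (_ : (a i).+1 * #|{: grid}| <= _).
    by rewrite mulSn addnC /a (negPf iN) ltn_add2r.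
  apply: leq_trans (leq_addr _ _); rewrite leq_mul2r; apply/orP; right.
  by rewrite qE iN addn1 leq_addr.
(* The missing mass is put on [i0], which belongs to [I]. *)
pose z i := a i + (i == i0) * (k - \sum_i a i).
exists z; split; first by rewrite sum_add_at subnKC.
move=> i zi; have iN : inl i \notin s.
  move: zi; rewrite /z /a; have [->|ii0] := eqVneq i i0; first by [].
  by case: ifP.
have [p ps ci] := real i iN; exists (fun j => val p j : nat); split => //.
apply: leq_trans (_ : \sum_j ((val p j - a j) + (z j - a j)) <= _).
  apply: leq_sum => j _; have := ale p j ps; rewrite /z.
  by move: (_ * _) => e ?; lia.
have sz : \sum_j z j = k by rewrite sum_add_at subnKC.
rewrite big_split /= !sumnB; [|by move=> j _; rewrite leq_addr|by move=> j _; apply: ale].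
rewrite sz sumgrid addnn -mul2n leq_mul2l /= leq_subLR; exact: ltnW.
Qed.

End Grid.

Import Order.TTheory GRing.Theory Num.Theory.
Import numFieldNormedType.Exports.

Local Open Scope classical_set_scope.
Local Open Scope ring_scope.

(** * Convexity and compactness in normed spaces *)

Section Convex.
Context {R : realType} {E : normedModType R}.

Lemma convexP (A : set E) : @convex_set R E A <->
  forall x y (t : R), 0 <= t -> t <= 1 -> A x -> A y -> A (t *: x + (1 - t) *: y).
Proof.
split=> [cA x y t t0 t1 Ax Ay|cA x y l].
  by have := cA x y (Itv01 t0 t1); rewrite !inE; apply.
rewrite !inE => Ax Ay; apply: cA => //.
Qed.

(** The weights are normalized in the conclusion rather than assumed to have
    sum 1, so that the induction on [n] can drop the last one. *)
Lemma convex_sum (A : set E) n (c : 'I_n -> R) (v : 'I_n -> E) :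
  @convex_set R E A -> (forall i, 0 <= c i) -> (forall i, A (v i)) ->
  0 < \sum_i c i -> A ((\sum_i c i)^-1 *: \sum_i c i *: v i).
Proof.
move=> /convexP cA; elim: n c v => [|n IH] c v c0 Av; first by rewrite big_ord0 ltxx.
rewrite !big_ord_recr /=; set w := widen_ord _.
have : 0 <= \sum_i c (w i) by apply: sumr_ge0.
rewrite le_eqVlt => /predU1P[/esym s0|s0 pos].
  rewrite s0 add0r => cn; rewrite big1 ?add0r ?scalerA ?mulVf ?scale1r ?gt_eqF //.
  by move=> i _; rewrite (psumr_eq0P (fun j _ => c0 (w j)) s0) // scale0r.
set S := \sum_i _ in s0 pos *; set V := \sum_i _; set cn := c _ in pos *.
have -> : (S + cn)^-1 *: (V + cn *: v ord_max) =
    (S / (S + cn)) *: (S^-1 *: V) + (1 - S / (S + cn)) *: v ord_max.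
  rewrite scalerA mulrAC divff ?gt_eqF // mul1r scalerDr scalerA; congr (_ + _ *: _).
  by rewrite -{1}(@divff _ (S + cn)) ?gt_eqF // -mulrBl addrAC subrr add0r mulrC.
apply: cA => //; last exact: IH.
  by rewrite divr_ge0 // ltW.
by rewrite ler_pdivrMr // mul1r lerDl c0.
Qed.

Lemma convex_closure (A : set E) : @convex_set R E A -> @convex_set R E (closure A).
Proof.
move=> /convexP cA; apply/convexP => x y t t0 t1 clx cly.
move=> B /nbhs_ballP[e /= e0 eB].
have [x' [Ax' xx']] := clx _ (nbhsx_ballx x e e0).
have [y' [Ay' yy']] := cly _ (nbhsx_ballx y e e0).
exists (t *: x' + (1 - t) *: y'); split; first exact: cA.
apply: eB; move: xx' yy'; rewrite -!ball_normE /= => xx' yy'.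
have -> : t *: x + (1 - t) *: y - (t *: x' + (1 - t) *: y') =
    t *: (x - x') + (1 - t) *: (y - y').
  by rewrite !scalerBr opprD addrACA.
apply: le_lt_trans (ler_normD _ _) _; rewrite !normrZ (ger0_norm t0) ger0_norm ?subr_ge0 //.
have [->|tn0] := eqVneq t 0; first by rewrite mul0r add0r subr0 mul1r.
rewrite -[e]mul1r -[X in X * e](subrKC t) [ltRHS]mulrDl ltr_leD //.
  by rewrite ltr_pM2l // lt_neqAle eq_sym tn0.
by rewrite ler_wpM2l ?subr_ge0 // ltW.
Qed.

Lemma convex_bigcap I (D : set I) (F : I -> set E) :
  (forall i, D i -> @convex_set R E (F i)) -> @convex_set R E (\bigcap_(i in D) F i).
Proof.
move=> cF; apply/convexP => x y t t0 t1 Fx Fy i Di.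
by have /convexP := cF i Di; apply => //; [exact: Fx|exact: Fy].
Qed.

Lemma convex_conv_hull (A : set E) : @convex_set R E (conv_hull A).
Proof. by apply: convex_bigcap => B []. Qed.

Lemma seq_pos_lower_bound (s : seq E) (f : E -> R) :
  (forall y, y \in s -> 0 < f y) ->
  exists2 l, 0 < l & forall y, y \in s -> l <= f y.
Proof.
elim: s => [|y s IH] f0; first by exists 1.
have [|l l0 lf] := IH; first by move=> z zs; apply: f0; rewrite inE zs orbT.
exists (Num.min l (f y)); first by rewrite lt_min l0 f0 // mem_head.
move=> z; rewrite inE => /predU1P[->|/lf lz]; rewrite ge_min ?lexx ?orbT //.
by rewrite lz.
Qed.

(** A form of Lebesgue's number lemma: take a finite cover of [K] by balls of
    radii [delta y / 2], and for [l] a lower bound of these radii. *)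
Lemma compact_net (K : set E) (delta : E -> R) :
  compact K -> (forall x, K x -> 0 < delta x) ->
  exists s : seq E, (forall y, y \in s -> K y) /\
    exists2 l, 0 < l & forall x, K x ->
      exists2 y, y \in s & forall x', `|x - x'| < l -> `|y - x'| < delta y.
Proof.
rewrite compact_cover => cK d0.
have [] := cK E K (fun y => ball y (delta y / 2)).
- by move=> y Ky; apply: ball_open; rewrite divr_gt0 // d0.
- by move=> x Kx; exists x => //; apply: ballxx; rewrite divr_gt0 // d0.
move=> D DK covD; have sK y : y \in enum_fset D -> K y by move=> /DK; rewrite inE.
exists (enum_fset D); split => //.
have [l l0 lmin] : exists2 l, 0 < l & forall y, y \in enum_fset D -> l <= delta y / 2.
  by apply: seq_pos_lower_bound => y /sK Ky; rewrite divr_gt0 // d0.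
exists l => // x /covD[y /= yD xy]; exists y => // x' xx'.
move: xy; rewrite -ball_normE /= => yx.
rewrite (le_lt_trans (ler_distD x _ _)) // [ltRHS]splitr ltrD //.
by apply: lt_le_trans xx' _; apply: lmin.
Qed.

End Convex.

(** * Fixed points of continuous multimaps of a compact convex set *)

Section MultiComp.
Context {S T U : topologicalType}.

Lemma open_subspace_preimage (D : set S) (D' : set T) (f : S -> T) (A : set T) :
  continuous f -> (forall x, D x -> D' (f x)) ->
  open (A : set (subspace D')) ->
  open ([set x | D x /\ A (f x)] : set (subspace D)).
Proof.
move=> cf fD /open_subspaceP[W oW eW]; apply/open_subspaceP.
have WA x : D x -> W (f x) <-> A (f x).
  move=> /fD Dfx; have : (W `&` D') (f x) <-> (A `&` D') (f x) by rewrite eW.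
  by move=> [WA AW]; split=> ?; [case: WA|case: AW].
exists (f @^-1` W); first by apply: open_comp.
apply/seteqP; split=> x /=; first by move=> [Wx Dx]; split=> //; split=> //; exact/WA.
by move=> [[_ Ax] Dx]; split=> //; exact/WA.
Qed.

Lemma multi_continuous_on_comp (D : set S) (D' : set T) (f : S -> T)
    (G : T -> set U) :
  continuous f -> (forall x, D x -> D' (f x)) ->
  multi_continuous_on D' G -> multi_continuous_on D (G \o f).
Proof.
move=> cf fD [uscG lscG]; split=> V oV.
  rewrite (_ : mkset _ = [set x | D x /\ [set y | D' y /\ G y `<=` V] (f x)]).
    by apply: open_subspace_preimage; last exact: uscG.
  by apply/seteqP; split=> x /= [Dx]; [split=> //; split=> //; exact: fD|case].
rewrite (_ : mkset _ = [set x | D x /\ [set y | D' y /\ G y `&` V !=set0] (f x)]).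
  by apply: open_subspace_preimage; last exact: lscG.
by apply/seteqP; split=> x /= [Dx]; [split=> //; split=> //; exact: fD|case].
Qed.

End MultiComp.

Section Kakutani.
Context {R : realType} {E : normedModType R}.

Lemma open_subspace_ball (D A : set E) x : open (A : set (subspace D)) -> D x -> A x ->
  exists2 d, 0 < d & forall y, D y -> `|x - y| < d -> A y.
Proof.
move=> /open_subspaceP[W oW eW] Dx Ax.
have Wx : W x by have : (W `&` D) x; [rewrite eW|case].
have /nbhs_ballP[d /= d0 dW] : nbhs x W by apply: open_nbhs_nbhs.
exists d => // y Dy xy; have : (W `&` D) y.
  by split => //; apply: dW; rewrite -ball_normE.
by rewrite eW => -[].
Qed.

Lemma ler_distn_nat (a b : nat) : `|a%:R - b%:R| <= ((a - b) + (b - a))%:R :> R.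
Proof.
have [/ltnW ab|ba] := ltnP a b.
  by rewrite (eqP (ab : a - b == 0)%N) distrC -natrB // ger0_norm ?ler0n.
by rewrite (eqP (ba : b - a == 0)%N) addn0 -natrB // ger0_norm ?ler0n.
Qed.

(** Each center [c] of the net comes with a point [(ctr c).1] to which [H] stays
    close on a whole ball around [c], by lower semicontinuity. *)
Lemma approx_fixed_point (K : set E) (H : E -> set E) (e : R) :
  compact K -> K !=set0 -> @convex_set R E K ->
  (forall x, K x -> [/\ H x !=set0, @convex_set R E (H x) & H x `<=` K]) ->
  multi_lsc_on K H -> 0 < e ->
  exists x y, [/\ K x, H x y & `|x - y| < e].
Proof.
move=> cK [x0 Kx0] cvK HK lscH e0.
have [ctr ctrP] : {ctr : E -> E * R & forall x, K x -> [/\ K (ctr x).1, 0 < (ctr x).2 &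
    forall x', K x' -> `|x - x'| < (ctr x).2 -> exists2 w, H x' w & `|(ctr x).1 - w| < e]}.
  apply: (@choice _ _ (fun x (p : E * R) => K x -> [/\ K p.1, 0 < p.2 &
    forall x', K x' -> `|x - x'| < p.2 -> exists2 w, H x' w & `|p.1 - w| < e])) => x.
  have [Kx|nKx] := pselect (K x); last by exists (x, 0).
  have [[y Hy] _ /(_ y Hy) Ky] := HK x Kx.
  have oB : open (ball y e) by exact: ball_open.
  have [|d d0 dP] := open_subspace_ball (lscH _ oB) Kx.
    split => //; exists y; split => //; exact: ballxx.
  exists (y, d) => _; split => //= x' Kx' /(dP _ Kx')[_ [w []]].
  by rewrite -ball_normE /=; exists w.
have radius_gt0 x : K x -> 0 < (ctr x).2 by case/ctrP.
have [s [sK [l l0 sP]]] := compact_net cK radius_gt0.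
have [a as_] : exists a, a \in s by have [a ? _] := sP x0 Kx0; exists a.
(* One more index than centers, so that there are at least two of them, as
   required by [scarf_grid]; the extra one falls on the default value of nth. *)
pose m := (size s).+1.
have m_gt1 : (1 < m)%N by rewrite ltnS lt0n size_eq0; apply: contraTneq as_ => ->.
pose y (j : 'I_m) : E := (ctr (nth a s j)).1.
have Ks j : K (nth a s j).
  apply: sK; have [js|sj] := ltnP j (size s); first exact: mem_nth.
  by rewrite nth_default.
have yK j : K (y j) by rewrite /y; have [] := ctrP _ (Ks j).
have [col colP] : {col : E -> 'I_m & forall x, K x -> forall x', K x' ->
    `|x - x'| < l -> exists2 w, H x' w & `|y (col x) - w| < e}.
  apply: (@choice _ _ (fun x j => K x -> forall x', K x' ->
    `|x - x'| < l -> exists2 w, H x' w & `|y j - w| < e)) => x.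
  have [Kx|nKx] := pselect (K x); last by exists ord0.
  have [b bs bP] := sP x Kx.
  have bm : (index b s < m)%N by rewrite ltnS index_size.
  exists (Ordinal bm) => _ x' Kx' /bP; rewrite /y /= nth_index //.
  by have [_ _] := ctrP b (sK b bs); apply.
pose M := \sum_j `|y j|.
have M0 : 0 <= M by apply: sumr_ge0.
(* Fine enough for grid points at distance at most [2 * m] to give points of
   [K] at distance less than [l]. *)
pose k := (Num.truncn ((2 * m)%:R * M / l)).+1.
have kP : (2 * m)%:R * M / l < k%:R by apply: truncnS_gt.
pose P (p : 'I_m -> nat) : E := k%:R^-1 *: \sum_j (p j)%:R *: y j.
have sumR (p : 'I_m -> nat) : (\sum_j p j)%N = k -> \sum_j (p j)%:R = k%:R :> R.
  by move=> <-; rewrite natr_sum.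
have convk (A : set E) (p : 'I_m -> nat) (v : 'I_m -> E) : @convex_set R E A ->
    (\sum_j p j)%N = k -> (forall j, A (v j)) -> A (k%:R^-1 *: \sum_j (p j)%:R *: v j).
  move=> cA pk Av; rewrite -(sumR p pk); apply: convex_sum => //.
  by rewrite sumR.
have PK p : (\sum_j p j)%N = k -> K (P p) by move=> pk; apply: convk.
have [z [zk zP]] := scarf_grid k m_gt1 (col \o P).
have Kz := PK z zk; have [[w0 Hw0] cvH _] := HK _ Kz.
have near j : (0 < z j)%N -> exists2 w, H (P z) w & `|y j - w| < e.
  move=> /zP[p [pk <- dpz]]; apply: colP => //; first exact: PK.
  rewrite /P -scalerBr normrZ -sumrB ger0_norm ?invr_ge0 ?ler0n //.
  rewrite mulrC ltr_pdivrMr ?ltr0n // mulrC -ltr_pdivrMr //; apply: le_lt_trans kP.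
  rewrite ler_pM2r ?invr_gt0 //; apply: le_trans (ler_norm_sum _ _ _) _.
  apply: le_trans (_ : \sum_i ((p i - z i) + (z i - p i))%:R * M <= _).
    apply: ler_sum => i _; rewrite -scalerBl normrZ ler_pM //.
      exact: ler_distn_nat.
    by rewrite /M (bigD1 i) //= lerDl sumr_ge0.
  by rewrite -mulr_suml ler_wpM2r // -natr_sum ler_nat.
have [w wP] : {w : 'I_m -> E & forall j, H (P z) (w j) /\ ((0 < z j)%N -> `|y j - w j| < e)}.
  apply: (@choice _ _ (fun j u => H (P z) u /\ ((0 < z j)%N -> `|y j - u| < e))) => j.
  have [/near[w Hw yw]|z0] := ltnP 0%N (z j); first by exists w.
  by exists w0.
exists (P z), (k%:R^-1 *: \sum_j (z j)%:R *: w j); split => //.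
  by apply: convk => // j; case: (wP j).
rewrite /P -scalerBr normrZ -sumrB ger0_norm ?invr_ge0 ?ler0n //.
rewrite mulrC ltr_pdivrMr ?ltr0n //; apply: le_lt_trans (ler_norm_sum _ _ _) _.
rewrite -(sumR z zk) mulr_sumr.
have [j zj] : exists j, (0 < z j)%N.
  apply/not_existsP => z0; move: zk; rewrite big1 // => j _.
  by apply/eqP; rewrite -leqn0 leqNgt; apply/negP/z0.
rewrite (bigD1 j) //= [ltRHS](bigD1 j) //= ltr_leD //.
  by rewrite -scalerBr normrZ normr_nat mulrC ltr_pM2r ?ltr0n //; case: (wP j) => _; apply.
apply: ler_sum => i _; rewrite -scalerBr normrZ normr_nat mulrC.
have [zi|] := ltnP 0%N (z i); first by rewrite ler_wpM2r // ltW //; case: (wP i) => _; apply.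
by rewrite leqn0 => /eqP ->; rewrite !mulr0.
Qed.

(** If [x] is not a fixed point then, by upper semicontinuity, the displacement
    between [x'] and the values at [x'] is bounded below for [x'] near [x]: the
    graph of [H] is closed.  Were there no fixed point, compactness would make
    this bound uniform, against [approx_fixed_point]. *)
Theorem kakutani (K : set E) (H : E -> set E) :
  compact K -> K !=set0 -> @convex_set R E K ->
  (forall x, K x -> P_cl_cv K (H x)) -> multi_continuous_on K H ->
  exists2 x, K x & H x x.
Proof.
move=> cK K0 cvK HK [uscH lscH]; apply: contrapT => nofix.
have [gap gapP] : {gap : E -> R & forall x, K x -> 0 < gap x /\
    forall x', `|x - x'| < gap x -> K x' -> forall y, H x' y -> gap x <= `|x' - y|}.
  apply: (@choice _ _ (fun x d => K x -> 0 < d /\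
    forall x', `|x - x'| < d -> K x' -> forall y, H x' y -> d <= `|x' - y|)) => x.
  have [Kx|nKx] := pselect (K x); last by exists 0.
  have [_ clH _ _] := HK x Kx.
  have nHx : (~` H x) x by move=> Hxx; apply: nofix; exists x.
  have /nbhs_ballP[r /= r0 rH] : nbhs x (~` H x).
    by apply: open_nbhs_nbhs; split => //; apply: closed_openC.
  have r2 : 0 < r / 2 by rewrite divr_gt0.
  have oV : open (~` closed_ball_ Num.norm x (r / 2)).
    by apply: closed_openC; apply: closed_closed_ball_.
  have [|d d0 dP] := open_subspace_ball (uscH _ oV) Kx.
    split => // y Hy /= xy; apply: (rH y) => //; rewrite -ball_normE /=.
    by apply: le_lt_trans xy _; rewrite ltr_pdivrMr // mulr_natr mulr2n ltrDl.
  exists (Num.min d (r / 2 / 2)) => _; split; first by rewrite lt_min d0 divr_gt0.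
  move=> x'; rewrite lt_min => /andP[xd xr] Kx' y Hy.
  have [_ /(_ y Hy) /= /negP] := dP x' Kx' xd; rewrite -ltNge => far.
  rewrite ge_min; apply/orP; right.
  rewrite leNgt; apply/negP => near.
  have := ler_distD x' x y; rewrite leNgt => /negP; apply.
  by apply: lt_trans far; rewrite [ltRHS]splitr ltrD.
have gap_gt0 x : K x -> 0 < gap x by case/gapP.
have [s [sK [l l0 sP]]] := compact_net cK gap_gt0.
have [mn mn0 mnP] := seq_pos_lower_bound (fun y ys => gap_gt0 y (sK y ys)).
have [|x [y [Kx Hy xy]]] := approx_fixed_point cK K0 cvK _ lscH mn0.
  by move=> x /HK[].
have [b bs bP] := sP x Kx; have [_ far] := gapP b (sK b bs).
have := far x (bP x _) Kx y Hy; rewrite subrr normr0 => /(_ l0).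
by rewrite leNgt (lt_le_trans xy) // mnP.
Qed.

End Kakutani.

(** * Invariant compact sets from a measure of noncompactness *)

Section Cvg.
Context {R : realType}.

(** The sequence is nonincreasing; if its limit [l] were positive, upper
    semicontinuity would give [phi < l] near [l], hence a term below [l]. *)
Lemma comparison_cvg0 (phi : R -> R) (u : R ^nat) :
  (forall r s : R, 0 <= r -> r <= s -> phi r <= phi s) ->
  real_usc_on [set r : R | 0 <= r] phi ->
  (forall r : R, 0 < r -> phi r < r) ->
  (forall k, 0 <= u k) -> (forall k, u k.+1 <= phi (u k)) ->
  u k @[k --> \oo] --> 0.
Proof.
move=> mono usc ltphi u0 uphi.
have phi_le r : 0 <= r -> phi r <= r.
  rewrite le_eqVlt => /predU1P[<-|/ltphi/ltW //].
  apply/ler_addgt0Pr => e e0; rewrite add0r.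
  by apply: le_trans (mono _ _ _ (ltW e0)) _ => //; apply/ltW/ltphi.
have ndu : nonincreasing_seq u.
  by apply/nonincreasing_seqP => k; apply: le_trans (uphi k) (phi_le _ (u0 k)).
have lbu : has_lbound (range u) by exists 0 => _ [k _ <-].
have := nonincreasing_cvgn ndu lbu; set l := inf _ => ul.
have lu k : l <= u k by apply: ge_inf => //; exists k.
have l0 : 0 <= l by apply: lb_le_inf; [exists (u 0%N); exists 0%N|move=> _ [k _ <-]].
move: (l0); rewrite le_eqVlt => /predU1P[->//|lpos].
have [|d d0 dP] := open_subspace_ball (usc l) l0; first by split => //; exact: ltphi.
have /cvgrPdist_lt/(_ d d0)[k _ kP] := ul.
have /= [_] := dP (u k) (u0 k) (kP k (leqnn k)).
by rewrite ltNge (le_trans (lu k.+1) (uphi k)).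
Qed.
End Cvg.

Section Mnc.
Context {R : realType} {E : normedModType R}.

Lemma sub_bounded_set (A B : set E) : A `<=` B -> bounded_set B -> bounded_set A.
Proof.
by move=> AB; apply: sub_boundedr => P PB x /AB; apply: PB.
Qed.

(** Taking convex hulls and closures leaves the measure unchanged, so only the
    application of [H] matters when measuring the iterated closed convex hulls
    [A k], and their intersection contains the values of [H] on it because
    [hull] is monotone. *)
Lemma mnc_invariant_compact (mu : set E -> R) (X : set E) (phi : R -> R) (H : E -> set E) :
  measure_of_noncompactness mu ->
  X !=set0 -> bounded_set X -> closed X -> @convex_set R E X ->
  (forall r s : R, 0 <= r -> r <= s -> phi r <= phi s) ->
  real_usc_on [set r : R | 0 <= r] phi ->
  (forall r : R, 0 < r -> phi r < r) ->
  (forall x, X x -> H x !=set0 /\ H x `<=` X) ->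
  (forall A, A !=set0 -> A `<=` X -> mu (multi_image H A) <= phi (mu A)) ->
  exists K : set E, [/\ K !=set0, K `<=` X, compact K, @convex_set R E K
    & forall x, K x -> H x `<=` K].
Proof.
move=> hmu X0 Xbd Xcl Xcv mono usc ltphi HX Hmu.
pose hull (A : set E) := closure (conv_hull (multi_image H A)).
pose A := fix A k := if k is k'.+1 then hull (A k') else X.
have hullX B : B `<=` X -> conv_hull (multi_image H B) `<=` X.
  move=> BX; apply: smallest_sub => // x [b /BX Xb].
  by have [_] := HX b Xb; apply.
have clX B : B `<=` X -> closure B `<=` X.
  by move=> BX; rewrite [X in _ `<=` X](iffLR (closure_id X)) //; apply: closureS.
have AX k : A k `<=` X by elim: k => [|k IH] //=; apply/clX/hullX.
have imX B : B `<=` X -> multi_image H B `<=` X.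
  by move=> /hullX; apply: subset_trans; apply: sub_gen_smallest.
have bd B : B `<=` X -> B !=set0 -> P_bd B.
  by move=> BX B0; split => //; apply: sub_bounded_set Xbd.
have im0 B : B `<=` X -> B !=set0 -> multi_image H B !=set0.
  by move=> BX [b Bb]; have [[y Hy] _] := HX b (BX b Bb); exists y; exists b.
have hull0 B : B `<=` X -> B !=set0 -> conv_hull (multi_image H B) !=set0.
  by move=> BX /(im0 B BX)[y By]; exists y; apply: sub_gen_smallest.
have A0 k : A k !=set0.
  elim: k => [|k IH] //=; have [y ?] := hull0 _ (AX k) IH.
  by exists y; apply: subset_closure.
have Acl k : closed (A k) by case: k => [|k] //=; apply: closed_closure.
have Acv k : @convex_set R E (A k).
  by case: k => [|k] //=; apply/convex_closure/convex_conv_hull.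
have AS k : A k.+1 `<=` A k.
  elim: k => [|k IH]; first exact: (AX 1%N).
  apply: closureS; apply: smallest_sub; first exact: convex_conv_hull.
  move=> y [x /IH Ax Hy]; apply: sub_gen_smallest; by exists x.
have Abd k : P_cl_bd (A k) by split => //; case: (bd _ (AX k) (A0 k)).
have muA k : mu (A k.+1) <= phi (mu (A k)).
  rewrite /= (mnc_closure hmu); last by apply: bd; [apply: hullX|apply: hull0].
  rewrite (mnc_conv hmu); last by apply: bd; [apply: imX|apply: im0].
  exact: Hmu.
have mu_to0 : mu (A k) @[k --> \oo] --> 0.
  by apply: (comparison_cvg0 (phi := phi)) => // k; apply: mnc_ge0.
pose K := \bigcap_k A k.
have K0 : K !=set0 := mnc_bigcap hmu Abd AS mu_to0.
have KA k : K `<=` A k by move=> x; apply.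
have KX : K `<=` X := KA 0%N.
have Kcl : closed K by apply: closed_bigI.
have Kbd : P_cl_bd K by split => //; case: (bd _ KX K0).
have muK : mu K = 0.
  apply/eqP; rewrite eq_le (mnc_ge0 hmu) // andbT leNgt; apply/negP => muK.
  have /cvgrPdist_lt/(_ _ muK)[k _ /(_ k (leqnn k))] := mu_to0.
  rewrite /= sub0r normrN ger0_norm ?(mnc_ge0 hmu) // ltNge.
  by rewrite (mnc_mono hmu) //; [apply: bd|apply: bd].
exists K; split => //.
- have [_] : P_rcp K by apply: (mnc_ker_rcp hmu).
  by rewrite precompactE -(iffLR (closure_id K)).
- by apply: convex_bigcap => k _.
move=> x Kx y Hy [|k] _; first by have [_ h] := HX x (KX x Kx); apply: h.
apply: subset_closure; apply: sub_gen_smallest; exists x => //; exact: KA.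
Qed.
End Mnc.

(** * Tuple fixed points *)

Theorem theorem5 (R : realType) (E : completeNormedModType R) (X : set E)
    (hX0 : X !=set0) (hXbd : bounded_set X) (hXcl : closed X)
    (hXcv : @convex_set R E X)
    (mu : set E -> R) (hmu : measure_of_noncompactness mu)
    (n : nat) (hn : (1 <= n)%N)
    (phi : R -> R)
    (hphi_ge0 : forall r : R, 0 <= r -> 0 <= phi r)
    (hphi_mono : forall r s : R, 0 <= r -> r <= s -> phi r <= phi s)
    (hphi_usc : real_usc_on [set r : R | 0 <= r] phi)
    (hphi_lt : forall r : R, 0 < r -> phi r < r)
    (G : {ptws 'I_n -> E} -> set E)
    (hG : forall x, box (fun=> X) x -> P_cl_cv X (G x))
    (hGcont : multi_continuous_on (box (fun=> X)) G)
    (hGmu : forall X_ : 'I_n -> set E,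
      (forall i, X_ i !=set0 /\ X_ i `<=` X) ->
      mu (multi_image G (box X_)) <= phi ((\sum_(i < n) mu (X_ i)) / n%:R)) :
  exists x : {ptws 'I_n -> E},
    box (fun=> X) x /\ forall i : 'I_n, G (cyclic_shift i x) (x i).
Proof.
pose diag (x : E) : {ptws 'I_n -> E} := fun=> x.
have diag_cont : continuous diag.
  move=> x; apply/cvg_sup => i A [_ [[V oV <-] Vx] VA].
  apply: (filterS _ (open_nbhs_nbhs (conj oV Vx))) => y Vy; exact: VA.
have diagX x : X x -> box (fun=> X) (diag x) by move=> Xx i.
have HX x : X x -> P_cl_cv X ((G \o diag) x) by move=> /diagX/hG.
have bdX (A : set E) : A `<=` X -> A !=set0 -> P_bd A.
  by move=> AX A0; split => //; apply: sub_bounded_set hXbd.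
have imX (A : set E) : A !=set0 -> A `<=` X -> mu (multi_image (G \o diag) A) <= phi (mu A).
  move=> A0 AX; have [a Aa] := A0.
  have := hGmu (fun=> A) (fun=> conj A0 AX).
  rewrite sumr_const card_ord -[mu A *+ n]mulr_natr mulfK ?pnatr_eq0 -?lt0n //.
  apply: le_trans; apply: (mnc_mono hmu).
  - apply: bdX => [y [x /AX/HX[_ _ _ GX] /GX]//|].
    by have [[y Gy] _ _ _] := HX a (AX a Aa); exists y; exists a.
  - apply: bdX => [y [x Ax Gy]|].
      by have [|_ _ _] := hG x; [move=> i; apply/AX/Ax|apply].
    by have [[y Gy] _ _ _] := HX a (AX a Aa); exists y; exists (diag a).
  - by move=> y [x Ax Gy]; exists (diag x).
have [K [K0 KX cK cvK HK]] := mnc_invariant_compact hmu hX0 hXbd hXcl hXcv hphi_mono hphi_usc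
  hphi_lt (fun x Xx => let: And4 h1 _ _ h2 := HX x Xx in conj h1 h2) imX.
have [|x Kx Gx] := @kakutani R E K (G \o diag) cK K0 cvK _
    (multi_continuous_on_comp diag_cont (fun x Kx => diagX x (KX x Kx)) hGcont).
  by move=> x Kx; have [? ? ? _] := HX x (KX x Kx); split => //; apply: HK.
by exists (diag x); split; [apply/diagX/KX|].
Qed.
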